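(* Consider the network $$\dot{\mathbf{X}}=\mathbf{F}(\mathbf{X})-c(L\otimes I_n)\mathbf{G}(\mathbf{X}),\qquad \mathbf{X}\in\mathbb{R}^{nN},$$ with equilibrium point $\mathbf{S}=0\in\mathbb{R}^{nN}$, and let $\mathcal{X}\subset\mathbb{R}^{nN}$ and $\mathcal{X}_T\subset\mathcal{X}$ be the state set and target set. If there exist $\lambda>0$ and a continuously differentiable function $V:\overline{\mathcal{X}}\to\mathbb{R}$ satisfying $$\mathcal{L}_V(\mathbf{X})-\lambda V(\mathbf{X})\ge 0\quad \forall\,\mathbf{X}\in\overline{\mathcal{X}\setminus\mathcal{X}_T},$$ $$V(\mathbf{X})\le 0\quad\forall\,\mathbf{X}\in\partial\mathcal{X},$$ then $\mathcal{R}=\{\mathbf{X}\in\mathcal{X}\mid V(\mathbf{X})>0\}$ is a subset of the region of synchronization (ROS) around the equilibrium point of the network. That is, for every $\mathbf{X}_0\in\mathcal{R}$ there exists $T>0$ such that the trajectory $\mathbf{X}(t)$ with $\mathbf{X}(0)=\mathbf{X}_0$ satisfies $\mathbf{X}(T)\in\mathcal{X}_T$ and $\mathbf{X}(t)\in\mathcal{X}$ for all $t\in[0,T]$.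
   Context: Network data: $\mathbf{X}=[\mathbf{x}_1^\top,\ldots,\mathbf{x}_N^\top]^\top\in\mathbb{R}^{nN}$ with $\mathbf{x}_i\in\mathbb{R}^n$; $\mathbf{F}(\mathbf{X})=[f^\top(\mathbf{x}_1),\ldots,f^\top(\mathbf{x}_N)]^\top$ and $\mathbf{G}(\mathbf{X})=[g^\top(\mathbf{x}_1),\ldots,g^\top(\mathbf{x}_N)]^\top$, where $f:\mathbb{R}^n\to\mathbb{R}^n$ is a smooth vector field and $g:\mathbb{R}^n\to\mathbb{R}^n$ is the nonlinear coupling function; $c>0$ is the coupling strength; $\otimes$ is the Kronecker product; $I_n$ is the $n\times n$ identity; $L=(L_{ij})\in\mathbb{R}^{N\times N}$ is the Laplacian matrix of a digraph: for $i\neq j$, $L_{ij}<0$ if there is a directed connection from node $j$ to node $i$ and $L_{ij}=0$ otherwise, and $L_{ii}=-\sum_{j\ne i}L_{ij}$. For any initial state $\mathbf{X}_0\in\mathbb{R}^{nN}$ the solution trajectory is defined on $[0,+\infty)$. The synchronization manifold is taken to be the equilibrium point $\mathbf{S}=[0_n^\top,\ldots,0_n^\top]^\top\in\mathbb{R}^{nN}$. State and target sets: $h:\mathbb{R}^{nN}\to\mathbb{R}$ is continuous and $\mathcal{X}=\{\mathbf{X}\mid h(\mathbf{X})>0\}$ is a bounded open set, with closure $\overline{\mathcal{X}}=\{\mathbf{X}\mid h(\mathbf{X})\ge0\}$ and boundary $\partial\mathcal{X}=\{\mathbf{X}\mid h(\mathbf{X})=0\}$. For a constant $\varepsilon>0$,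 $\mathcal{X}_T=\{\mathbf{X}\in\mathbb{R}^{nN}\mid\|\mathbf{X}\|<\varepsilon\}$ (Euclidean norm), and $\mathcal{X}_T\subset\mathcal{X}$. $\mathcal{L}_V(\mathbf{X})=\nabla V(\mathbf{X})\,\dot{\mathbf{X}}=\nabla V(\mathbf{X})\big(\mathbf{F}(\mathbf{X})-c(L\otimes I_n)\mathbf{G}(\mathbf{X})\big)$. ROS around the equilibrium point: the set of $\mathbf{X}_0\in\mathbb{R}^{nN}$ for which there exists $T>0$ such that the trajectory $\mathbf{X}(t)$ starting from $\mathbf{X}_0$ satisfies $\mathbf{X}(T)\in\mathcal{X}_T$ and $\mathbf{X}(t)\in\mathcal{X}$ for all $t\in[0,T]$. *)

(* Defs.v *)
From HB Require Import structures.
From mathcomp Require Import all_boot all_order all_algebra.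
From mathcomp Require Import all_classical all_reals all_analysis.
From mathcomp.real_closed Require Export mxtens.

Set Implicit Arguments.
Unset Strict Implicit.
Unset Printing Implicit Defensive.

Import Order.TTheory GRing.Theory Num.Theory.
Import numFieldNormedType.Exports.

Local Open Scope classical_set_scope.
Local Open Scope ring_scope.

Definition enorm (R : realType) (m : nat) (x : 'cV[R]_m) : R :=
  Num.sqrt (\sum_i x i 0 ^+ 2).

Definition boundary (T : topologicalType) (A : set T) : set T :=
  closure A `\` interior A.

Fixpoint Ck (R : realType) (U W : normedModType R) (k : nat) (f : U -> W)
    : Prop :=
  if k is k'.+1 then
    continuous f /\
    forall v : U, (forall x, derivable f x v) /\ Ck k' (fun x => 'D_v f x)
  else continuous f.

Definition smooth (R : realType) (U W : normedModType R) (f : U -> W) : Prop :=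
  forall k, Ck k f.

(* [e j i] means that there is a directed connection from [j] to [i]. *)
Definition is_laplacian (R : realType) (N : nat) (e : rel 'I_N) (L : 'M[R]_N)
    : Prop :=
  (forall i j, i != j -> (e j i -> L i j < 0) /\ (~~ e j i -> L i j = 0)) /\
  (forall i, L i i = - \sum_(j | j != i) L i j).

(* The stacked state of [N] nodes in R^n has coordinate [j] of node [i] at
   position [mxtens_index (i, j)], i.e. [i * n + j]: this is the indexing of
   the Kronecker product [*t]. *)
Definition node (R : realType) (N n : nat) (X : 'cV[R]_(N * n)) (i : 'I_N)
    : 'cV[R]_n :=
  \col_j X (mxtens_index (i, j)) 0.

Definition stack_map (R : realType) (N n : nat) (f : 'cV[R]_n -> 'cV[R]_n)
    (X : 'cV[R]_(N * n)) : 'cV[R]_(N * n) :=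
  \col_k f (node X (mxtens_unindex k).1) (mxtens_unindex k).2 0.

Definition network (R : realType) (N n : nat) (f g : 'cV[R]_n -> 'cV[R]_n)
    (c : R) (L : 'M[R]_N) (X : 'cV[R]_(N * n)) : 'cV[R]_(N * n) :=
  stack_map f X - c *: ((L *t (1%:M : 'M[R]_n)) *m stack_map g X).

(* A solution of x' = vf x on [0, +oo[, with the right derivative at 0;
   values at negative times are irrelevant. *)
Definition is_trajectory (R : realType) (m : nat) (vf : 'cV[R]_m -> 'cV[R]_m)
    (x0 : 'cV[R]_m) (x : R -> 'cV[R]_m) : Prop :=
  [/\ x 0 = x0,
      t^-1 *: (x t - x 0) @[t --> 0^'+] --> vf (x 0)
    & forall t : R, 0 < t -> is_derive t 1 x (vf (x t))].

Definition gradient (R : realType) (m : nat) (V : 'cV[R]_m -> R)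
    (x : 'cV[R]_m) : 'rV[R]_m :=
  \row_j 'D_(delta_mx j 0) V x.

(* V is continuously differentiable on the closure of the open set A, with
   gradient dV: V is differentiable in A, and V and its gradient extend
   continuously to the closure.  Since dV is continuous up to the boundary, it
   is determined by V on [closure A]; there it is the ordinary gradient
   whenever V is C^1 on a neighbourhood of [closure A].  The values of V and dV
   outside [closure A] are irrelevant. *)
Definition C1_closure (R : realType) (m : nat) (A : set 'cV[R]_m)
    (V : 'cV[R]_m -> R) (dV : 'cV[R]_m -> 'rV[R]_m) : Prop :=
  [/\ {within closure A, continuous V},
      {within closure A, continuous dV},
      forall x, A x -> differentiable V x
    & forall x, A x -> dV x = gradient V x].

Definition lie_derivative (R : realType) (m : nat) (dV : 'cV[R]_m -> 'rV[R]_m)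
    (vf : 'cV[R]_m -> 'cV[R]_m) (x : 'cV[R]_m) : R :=
  (dV x *m vf x) 0 0.

(* [phi x0] is the trajectory starting from [x0]. *)
Definition ROS (R : realType) (m : nat) (phi : 'cV[R]_m -> R -> 'cV[R]_m)
    (A A_T : set 'cV[R]_m) : set 'cV[R]_m :=
  [set x0 | exists T : R, [/\ 0 < T, A_T (phi x0 T)
    & forall t : R, 0 <= t <= T -> A (phi x0 t)]].

(* Main.v *)
(* Along a trajectory x that stays in X and off X_T, (V(x(t)) e^(-lambda t))'
   is nonnegative, so V(x(t)) >= e^(lambda t) V(x(0)) > 0.  Suppose x never
   enters X_T before leaving X.  If x first leaves X at time tau, then
   x(tau) lies on the boundary, where V <= 0: contradiction.  If x never leaves
   X, then V is unbounded on the compact closure of X: contradiction. *)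
Require Import Defs.
From mathcomp Require Import all_boot all_order all_algebra.
From mathcomp Require Import all_classical all_reals all_analysis.

Import Order.TTheory GRing.Theory Num.Theory.
Import numFieldNormedType.Exports.

Local Open Scope classical_set_scope.
Local Open Scope ring_scope.

(** Heine-Borel for row vectors carries over to columns through transposition, which does not
    increase the norm and is therefore continuous. *)
Lemma bounded_closed_compact_cV (R : realType) (m : nat) (A : set 'cV[R]_m) :
  bounded_set A -> closed A -> compact A.
Proof.
have normT p q (M : 'M[R]_(p, q)) : `|M^T| <= `|M|.
  rewrite [leLHS]mx_normrE; apply/bigmax_leP; split=> // -[i j] _ /=.
  rewrite mxE [leRHS]mx_normrE.
  exact: (le_bigmax _ (fun ij => `|M ij.1 ij.2|) (j, i)).
have trC p q : continuous (@trmx R p q).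
  move=> x; apply/(@cvgrPdist_le _ _ _ (nbhs x) (nbhs_filter x)) => e e0.
  have /cvgrPdist_le/(_ _ e0) := @cvg_id _ (nbhs x).
  by apply: filterS => y; rewrite -linearB; exact: le_trans (normT _ _ _).
move=> [M [Mreal bA]] clA.
have cK : compact ((@trmx R 1 m) @^-1` A).
  apply: bounded_closed_compact.
    exists M; split=> // r /bA Ar x /= /Ar /=; apply: le_trans.
    by have := normT _ _ x^T; rewrite trmxK.
  by apply: preimage_closed => // x _; exact: trC.
have -> : A = (@trmx R 1 m) @` ((@trmx R 1 m) @^-1` A).
  apply/seteqP; split=> [x Ax|_ [y /= Ay <-]//].
  by exists x^T; rewrite /= trmxK.
by apply: continuous_compact => //; apply: continuous_subspaceT; exact: trC.
Qed.

Lemma bounded_set_closure (R : realType) (W : normedModType R) (A : set W) :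
  bounded_set A -> bounded_set (closure A).
Proof.
move=> [M [Mreal bA]]; exists M; split=> // r /bA Ar.
have clr : closed [set x : W | `|x| <= r].
  apply: (@preimage_closed _ _ (fun x : W => `|x|) [set y | y <= r]).
    by move=> x _; exact: norm_continuous.
  exact: closed_le.
by rewrite /globally/= => x /(closureS Ar); rewrite -(closure_id _).1.
Qed.

Lemma within_continuous_comp_sub (T U W : topologicalType) (A : set T)
    (B : set U) (x : T -> U) (k : U -> W) :
  (forall t, A t -> B (x t)) -> {within A, continuous x} ->
  {within B, continuous k} -> {within A, continuous (fun t => k (x t))}.
Proof.
move=> AB /subspace_continuousP xC /subspace_continuousP kC.
apply/subspace_continuousP => t At.
move=> P /(kC _ (AB _ At))/(xC _ At); rewrite !nbhs_simpl /= => kP.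
apply: (filterS _ (kP : nbhs t _)) => s kPs As.
exact: kPs As (AB _ As).
Qed.

(** The witness is the infimum of the times [t >= 0] with [u t <= 0]. By continuity, a positive
    value there would keep nearby points out of that set, and a negative value would spread to
    earlier times. Applied to [h] along a trajectory, this gives the first exit time. *)
Lemma first_zero (R : realType) (u : R -> R) (t1 : R) :
  {within `[0, +oo[, continuous u} -> 0 < u 0 -> 0 <= t1 -> u t1 <= 0 ->
  exists tau, [/\ 0 < tau, u tau = 0 & forall t, 0 <= t < tau -> 0 < u t].
Proof.
move=> /subspace_continuousP uC u0 t10 ut1.
pose S := [set t | 0 <= t /\ u t <= 0].
have lbS : lbound S 0 by move=> t [].
have infS : has_inf S by split; [exists t1 | exists 0].
have tau0 : 0 <= inf S by apply: lb_le_inf => //; case: infS.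
have before t : 0 <= t < inf S -> 0 < u t.
  move=> /andP[t0 tS]; rewrite ltNge; apply/negP => ut.
  by move: tS; rewrite ltNge => /negP; apply; apply: ge_inf; [case: infS|split].
have near_tau (P : set R) : (\forall t \near within `[0, +oo[ (nbhs (inf S)), P t) ->
    exists2 d, 0 < d & forall t, 0 <= t -> `|inf S - t| < d -> P t.
  move=> /nbhs_ballP[d d0 dP]; exists d => // t t0 td.
  by apply: dP => //=; rewrite in_itv/= t0.
have cvg_tau := uC (inf S).
have ut_le : u (inf S) <= 0.
  rewrite leNgt; apply/negP => ut.
  have [|d d0 dP] := near_tau (fun t => 0 < u t).
    by apply: (cvgr_gt _ (cvg_tau _)) => //=; rewrite in_itv/= tau0.
  have [s [s0 us] sd] := inf_adherent d0 infS.
  have := ge_inf (ex_intro _ 0 lbS) (conj s0 us) => Ss.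
  have := dP s s0; rewrite ler0_norm ?subr_le0// opprB ltrBlDl => /(_ sd).
  by rewrite ltNge us.
have taugt0 : 0 < inf S.
  rewrite lt_neqAle tau0 andbT eq_sym; apply: contraTneq ut_le => ->.
  by rewrite -ltNge.
exists (inf S); split=> //; apply/eqP; rewrite eq_le ut_le/= leNgt.
apply/negP => ut.
have [|d d0 dP] := near_tau (fun t => u t < 0).
  by apply: (cvgr_lt _ (cvg_tau _)) => //=; rewrite in_itv/= tau0.
(* An earlier time within distance [d] of the infimum; the maximum with 0 keeps it in the half-line
   where [u] is known to be continuous. *)
pose s := Num.max 0 (inf S - d / 2).
have s0 : 0 <= s by rewrite le_max lexx.
have sS : s < inf S by rewrite gt_max taugt0/= ltrBlDr ltrDl divr_gt0.
have := dP s s0; rewrite gtr0_norm ?subr_gt0// ltrBlDr -ltrBlDl.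
have -> : inf S - d < s.
  by rewrite lt_max; apply/orP; right; rewrite ltrD2l ltrN2 ltr_pdivrMr// ltr_pMr// ltr1n.
by move=> /(_ isT); rewrite ltNge ltW// before// s0.
Qed.

Lemma trajectory_continuous (R : realType) (m : nat)
    (vf : 'cV[R]_m -> 'cV[R]_m) (x0 : 'cV[R]_m) (x : R -> 'cV[R]_m) :
  is_trajectory vf x0 x -> {within `[0, +oo[, continuous x}.
Proof.
move=> [_ xcvg xder]; apply/continuous_within_itvcyP; split.
  move=> t; rewrite in_itv/= andbT => t0.
  apply: differentiable_continuous; apply/derivable1_diffP.
  by case: (xder _ t0).
have t0 : t @[t --> (0:R)^'+] --> (0:R).
  by apply: cvg_at_right_filter; exact: cvg_id.
(* For [t > 0], [x t] is [t] times the difference quotient plus [x 0]; the first term tends to 0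
   because the quotient converges. *)
have := cvgD (cvgZ t0 xcvg) (cvg_cst (x 0)).
rewrite scale0r add0r => H; apply: cvg_trans (H _ _ _); apply: near_eq_cvg.
near=> t; rewrite fctE /= scalerA divff ?scale1r ?subrK//.
Unshelve. all: by end_near. Qed.

(** Expand [v] in the standard basis and use linearity of the differential. *)
Lemma diff_gradient (R : realType) (m : nat) (V : 'cV[R]_m -> R)
    (y v : 'cV[R]_m) :
  differentiable V y -> 'd V y v = (gradient V y *m v) 0 0.
Proof.
move=> dV; rewrite {1}[v]matrix_sum_delta linear_sum mxE; apply: eq_bigr => i _.
rewrite big_ord1 linearZ /= mxE deriveE// mulrC; congr *%R.
Qed.

Lemma is_derive_along_trajectory (R : realType) (m : nat)
    (V : 'cV[R]_m -> R) (x : R -> 'cV[R]_m) (t : R) (v : 'cV[R]_m) :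
  differentiable V (x t) -> is_derive t 1 x v ->
  is_derive t 1 (fun s => V (x s)) ((gradient V (x t) *m v) 0 0).
Proof.
move=> dV xv.
have dx : differentiable x t by apply/derivable1_diffP; by case: xv.
have dVx : differentiable (V \o x) t by exact: differentiable_comp.
apply: DeriveDef; first by apply/derivable1_diffP.
rewrite deriveE// -/(V \o x) diff_comp//= -diff_gradient//; congr ('d V _ _).
by rewrite -deriveE// derive_val.
Qed.

(** [W t = expR (- lambda * t) * V (x t)] is nondecreasing. Membership in [A] is asked only at
    interior times, so that [tau] may be the exit time, with [x tau] on the boundary. *)
Lemma exponential_growth (R : realType) (m : nat)
    (vf : 'cV[R]_m -> 'cV[R]_m) (A : set 'cV[R]_m) (V : 'cV[R]_m -> R)
    (dV : 'cV[R]_m -> 'rV[R]_m) (lambda tau : R) (x0 : 'cV[R]_m)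
    (x : R -> 'cV[R]_m) :
  C1_closure A V dV -> is_trajectory vf x0 x -> 0 < tau ->
  (forall t, 0 <= t <= tau -> closure A (x t)) ->
  (forall t, 0 < t < tau -> A (x t)) ->
  (forall t, 0 < t < tau -> lambda * V (x t) <= lie_derivative dV vf (x t)) ->
  expR (lambda * tau) * V x0 <= V (x tau).
Proof.
move=> [VC _ Vdiff dVE] xtraj tau0 clAx Ax Vgrow.
have xC := trajectory_continuous _ _ _ _ _ xtraj; have [x00 _ xder] := xtraj.
pose W t := expR (- lambda * t) * V (x t).
have Wder t : 0 < t < tau -> is_derive t 1 W
    (expR (- lambda * t) * (lie_derivative dV vf (x t) - lambda * V (x t))).
  move=> tI; have /andP[t0 _] := tI.
  have dVx := is_derive_along_trajectory _ _ _ _ _ _ (Vdiff _ (Ax _ tI))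
    (xder _ t0).
  rewrite -dVE in dVx; last exact: Ax.
  have dl : is_derive t (1:R) (fun s : R => - lambda * s) (- lambda).
    apply: is_derive_eq; by rewrite /GRing.scale /= mulr1.
  have de : is_derive t 1 (fun s => expR (- lambda * s))
     (expR (- lambda * t) * - lambda) by exact: is_derive1_comp.
  apply: (is_derive_eq (is_deriveM de dVx)).
  rewrite /GRing.scale/= /lie_derivative mulrBr; congr (_ + _).
  have swap (a b k : R) : a * (b * - k) = - (b * (k * a)).
    by rewrite !mulrN mulrC mulrA.
  exact: swap.
(* Monotonicity on the closed interval needs continuity at the endpoints, where it comes from
   continuity of [V] within [closure A]. *)
have WC : {within `[0, tau], continuous W}.
  have VxC : {within `[0, tau], continuous (fun t => V (x t))}.
    apply: (within_continuous_comp_sub _ _ _ _ _ _ _ _ _ VC).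
      by move=> t /=; rewrite in_itv/=; exact: clAx.
    apply: continuous_subspaceW xC => t /=.
    by rewrite !in_itv/= => /andP[->].
  move=> s; apply: cvgM; last exact: VxC.
  apply: continuous_subspaceT => r; apply: continuous_comp.
    by apply: cvgM; [exact: cvg_cst|exact: cvg_id].
  exact: continuous_expR.
have : W 0 <= W tau.
  apply: (ger0_derive1_ndecr _ _ WC) => // [s|s|]; last exact: ltW.
    by rewrite in_itv/= => /Wder[].
  rewrite in_itv/= => sI; rewrite derive1E (@derive_val _ _ _ _ _ _ _ (Wder _ sI)).
  by rewrite mulr_ge0 ?expR_ge0// subr_ge0 Vgrow.
rewrite /W mulr0 expR0 mul1r x00 mulNr expRN mulrC.
by rewrite ler_pdivlMr ?expR_gt0// mulrC.
Qed.


(** The argument for an arbitrary vector field and an arbitrary target set [B]. *)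
Lemma region_sub_ROS (R : realType) (m : nat) (vf : 'cV[R]_m -> 'cV[R]_m)
    (phi : 'cV[R]_m -> R -> 'cV[R]_m) (h V : 'cV[R]_m -> R)
    (dV : 'cV[R]_m -> 'rV[R]_m) (B : set 'cV[R]_m) (lambda : R) :
  (forall x0, is_trajectory vf x0 (phi x0)) ->
  continuous h ->
  bounded_set [set x | 0 < h x] ->
  closure [set x | 0 < h x] = [set x | 0 <= h x] ->
  0 < lambda -> C1_closure [set x | 0 < h x] V dV ->
  (forall x, 0 < h x -> ~ B x -> lambda * V x <= lie_derivative dV vf x) ->
  (forall x, h x = 0 -> V x <= 0) ->
  [set x | 0 < h x /\ 0 < V x] `<=` ROS phi [set x | 0 < h x] B.
Proof.
move=> phiT hC hbnd hcl lam0 VC1 Vgrow V0 x0 [hx0 Vx0].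
have xT := phiT x0; set x := phi x0 in xT *.
have x00 : x 0 = x0 by case: xT.
have [VC _ _ _] := VC1.
have hxC : {within `[0, +oo[, continuous (h \o x)}.
  apply: within_continuous_comp; first by move=> y _; exact: hC.
  exact: trajectory_continuous xT.
apply: contrapT => notROS.
(* Such a [t] would witness membership in [ROS]. Time 0 is excluded since [ROS] asks for [0 < T];
   the growth estimate uses only positive times. *)
have outB t : 0 < t -> (forall s, 0 <= s <= t -> 0 < h (x s)) -> ~ B (x t).
  by move=> t0 inA Bxt; apply: notROS; exists t.
have [stay|/existsNP[t1 /not_implyP[t10 /negP]]] :=
    pselect (forall t, 0 <= t -> 0 < h (x t)).
  have grow t : 0 < t -> expR (lambda * t) * V x0 <= V (x t).
    move=> t0; apply: (exponential_growth _ _ _ _ _ _ _ _ _ _ VC1 xT t0).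
    - by move=> s /andP[s0 _]; apply: subset_closure; exact: stay.
    - by move=> s /andP[s0 _]; apply: stay; exact: ltW.
    - move=> s /andP[s0 _]; apply: Vgrow; first by apply: stay; exact: ltW.
      by apply: outB => // r /andP[r0 _]; exact: stay.
  have clK := bounded_closed_compact_cV _ _ _ (bounded_set_closure _ _ _ hbnd)
    (@closed_closure _ _).
  have clx0 : closure [set y | 0 < h y] x0 by exact: subset_closure.
  have [y _ ymax] := compact_EVT_max (ex_intro _ x0 clx0) clK VC.
  have Vx0y : V x0 <= V y by apply: ymax; rewrite inE.
  (* Chosen so that [lambda * t * V x0 = V y]: then [expR (lambda * t) >= 1 + lambda * t] yields a
     value of at least [V x0 + V y], above the maximum [V y]. *)
  pose t := V y / (lambda * V x0).
  have t0 : 0 < t by rewrite divr_gt0 ?mulr_gt0// (lt_le_trans Vx0).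
  have : V y < expR (lambda * t) * V x0.
    have : 1 + lambda * t <= expR (lambda * t) by exact: expR_ge1Dx.
    rewrite -(ler_pM2r Vx0); apply: lt_le_trans.
    rewrite mulrDl mul1r mulrAC /t mulrC.
    by rewrite -mulrA mulVf ?mulr1 ?ltrDr// gt_eqF// mulr_gt0.
  apply/negP; rewrite -leNgt (le_trans (grow _ t0))// ymax// inE.
  by apply: subset_closure; apply: stay; exact: ltW.
rewrite -leNgt => ht1.
(* The trajectory leaves the state set, and [tau] is the first zero of [h] along it. *)
have [|tau [tau0 htau before]] := first_zero _ _ _ hxC _ t10 ht1.
  by rewrite /= x00.
have inA s : 0 <= s < tau -> 0 < h (x s) by exact: before.
have : expR (lambda * tau) * V x0 <= V (x tau).
  apply: (exponential_growth _ _ _ _ _ _ _ _ _ _ VC1 xT tau0).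
  (* At [s = tau], [h] vanishes, and [hcl] places the point in the closure. *)
  - move=> s /andP[s0]; rewrite le_eqVlt => /predU1P[->|stau].
      by rewrite hcl/= [h _]htau.
    by apply: subset_closure; apply: inA; rewrite s0.
  - by move=> s /andP[s0 stau]; apply: inA; rewrite ltW.
  - move=> s /andP[s0 stau]; apply: Vgrow; first by apply: inA; rewrite ltW.
    apply: outB => // r /andP[r0 rs]; apply: inA.
    by rewrite r0 (le_lt_trans rs).
apply/negP; rewrite -ltNge (le_lt_trans (V0 _ htau))//.
by rewrite mulr_gt0 ?expR_gt0.
Qed.

Theorem theorem2 (R : realType) (N n : nat)
  (f g : 'cV[R]_n -> 'cV[R]_n) (c : R) (e : rel 'I_N) (L : 'M[R]_N)
  (phi : 'cV[R]_(N * n) -> R -> 'cV[R]_(N * n))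
  (h : 'cV[R]_(N * n) -> R) (eps : R)
  (f_smooth : smooth f)
  (c_gt0 : 0 < c)
  (L_laplacian : is_laplacian e L)
  (phi_trajectory :
     forall X0, is_trajectory (network f g c L) X0 (phi X0))
  (equilibrium : network f g c L 0 = 0)
  (h_continuous : continuous h)
  (X_open : open [set X | 0 < h X])
  (X_bounded : bounded_set [set X | 0 < h X])
  (X_closure : closure [set X | 0 < h X] = [set X | 0 <= h X])
  (X_boundary : boundary [set X | 0 < h X] = [set X | h X = 0])
  (eps_gt0 : 0 < eps)
  (X_T_sub : [set X | enorm X < eps] `<=` [set X | 0 < h X])
  (lambda : R) (V : 'cV[R]_(N * n) -> R) (dV : 'cV[R]_(N * n) -> 'rV[R]_(N * n))
  (lambda_gt0 : 0 < lambda)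
  (V_C1 : C1_closure [set X | 0 < h X] V dV)
  (V_growth : forall X,
     closure ([set X | 0 < h X] `\` [set X | enorm X < eps]) X ->
     0 <= lie_derivative dV (network f g c L) X - lambda * V X)
  (V_boundary : forall X, boundary [set X | 0 < h X] X -> V X <= 0) :
  [set X | 0 < h X /\ 0 < V X] `<=`
    ROS phi [set X | 0 < h X] [set X | enorm X < eps].

Proof.
apply: (region_sub_ROS _ _ _ _ _ _ _ _ _ phi_trajectory h_continuous X_bounded
  X_closure lambda_gt0 V_C1) => x hx.
  by move=> xT; rewrite -subr_ge0; apply/V_growth/subset_closure.
by apply: V_boundary; rewrite X_boundary.
Qed.
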